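(* There are arbitrarily large integers $n$ for which there exists an $n$-point subset $X$ of $L_1$ such that for every integer $d\ge 1$ and every $d$-dimensional real normed space $Y$, any linear embedding of $X$ into $Y$ incurs distortion at least $$\sqrt{\frac{n-1}{2d}}.$$
   Context: $L_1$ denotes the real space $L_1[0,1]$ with its usual norm. A linear embedding of a set $X\subseteq L_1$ into a normed space $Y$ is the restriction to $X$ of a linear operator $T:L_1\to Y$. Its distortion is the least $D$ such that for some $s>0$, $s\|x-y\|_1\le\|T(x)-T(y)\|_Y\le D s\|x-y\|_1$ for all $x,y\in X$ ($D=\infty$ if there is none). *)

(* Defs.v *)
From HB Require Import structures.
From mathcomp Require Import all_boot all_order all_algebra.
From mathcomp Require Import all_classical all_reals all_analysis.
From mathcomp Require Import measurable_realfun.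
Set Implicit Arguments.
Unset Strict Implicit.
Unset Printing Implicit Defensive.
Import Order.TTheory GRing.Theory Num.Theory.
Import numFieldNormedType.Exports.
Local Open Scope classical_set_scope.
Local Open Scope ring_scope.

(* The library provides the elements of L^1(mu), i.e. almost-everywhere classes
   of integrable functions, without any algebraic structure on them.  They are
   made here into a normed space: all operations are those induced by the
   projection [Lspace_class] from the space of integrable functions. *)
Section LspaceType1_normedModType.
Context (d : measure_display) (T : measurableType d) (R : realType).
Variable mu : {measure set T -> \bar R}.

Local Notation fT := (LfunType mu (@lexx _ _ 1%E)).
Local Notation qT := ({mfun_ mu, T >-> measurableTypeR R}).
Local Notation L1 := (LspaceType1 mu).

Lemma Lnorm1_ae_eq (f g : T -> R) : measurable_fun setT f ->
  measurable_fun setT g -> f = g %[ae mu] ->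
  ('N[mu]_1[EFin \o f] = 'N[mu]_1[EFin \o g])%E.
Proof.
move=> mf mg fg; rewrite !Lnorm1; apply: ae_eq_integral => //=.
- by apply/measurable_EFinP; exact: measurableT_comp.
- by apply/measurable_EFinP; exact: measurableT_comp.
- by apply: filterS fg => x /= fgx _; rewrite fgx.
Qed.

Definition Lfun_aeEqMfun (f : fT) : qT :=
  \pi_qT%qT (HB.pack_for {mfun T >-> measurableTypeR R} (f : T -> R)
   (@isMeasurableFun.Build _ _ T (measurableTypeR R) f
      (@measurable_funPT _ _ _ _ f))).

Lemma Lfun_aeEqMfunK (f : fT) :
  (Lfun_aeEqMfun f : T -> R) = f %[ae mu].
Proof.
have /eqP := reprK (Lfun_aeEqMfun f).
by rewrite {2}/Lfun_aeEqMfun eqmodE => /asboolP.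
Qed.

Lemma Lspace_measurable (f : qT) : measurable_fun setT (f : T -> R).
Proof. exact: (@measurable_funPT _ _ _ _ (repr f)). Qed.

Lemma Lfun_aeEqMfun_finite (f : fT) :
  finite_norm mu 1 (Lfun_aeEqMfun f : T -> R).
Proof.
have := @Lnorm1_ae_eq (Lfun_aeEqMfun f) f (@Lspace_measurable _)
  (measurable_funPT f) (@Lfun_aeEqMfunK f).
rewrite /finite_norm => ->; exact: Lfunction_finite.
Qed.

Definition Lspace_class (f : fT) : L1 :=
  HB.pack_for L1 (Lfun_aeEqMfun f)
  (@isFinLebesgue.Build _ T R mu _ (@lexx _ _ 1%E) _ (Lfun_aeEqMfun_finite f)).

Lemma Lspace_Lfun (f : L1) : (f : T -> R) \in Lfun mu 1.
Proof.
by rewrite inE/=; apply/andP; split; rewrite inE/=;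
  [exact: Lspace_measurable|exact: Lebesgue_finite].
Qed.

Definition Lspace_repr (f : L1) : fT := Lfun_Sub (@lexx _ _ 1%E) (Lspace_Lfun f).

(* [f] and [g] are coerced to the underlying classes of measurable functions. *)
Lemma Lspace_inj (f g : L1) : (f : qT) = g -> f = g.
Proof.
case: f => f [[p]]; case: g => g [[q]] /= fg.
by case: _ / fg q => q; rewrite (Prop_irrelevance p q).
Qed.

Lemma Lspace_reprK (f : L1) : Lspace_class (Lspace_repr f) = f.
Proof.
apply: Lspace_inj => /=.
rewrite -[RHS]reprK; apply/eqP; rewrite eqmodE; apply/asboolP.
exact: ae_eq_refl.
Qed.

Lemma Lspace_classK (f : fT) :
  (Lspace_repr (Lspace_class f) : T -> R) = f %[ae mu].
Proof. exact: Lfun_aeEqMfunK. Qed.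

Lemma eq_Lspace_class (f g : fT) :
  (f : T -> R) = g %[ae mu] <-> Lspace_class f = Lspace_class g.
Proof.
split=> [fg|]; last first.
  move=> fg.
  apply: ae_eq_trans (ae_eq_sym (Lspace_classK f)) _.
  by rewrite fg; exact: Lspace_classK.
by apply: Lspace_inj => /=; apply/eqP; rewrite eqmodE; exact/asboolP.
Qed.

HB.instance Definition _ := gen_eqMixin L1.
HB.instance Definition _ := gen_choiceMixin L1.

Let zero : L1 := Lspace_class 0.
Let opp (f : L1) : L1 := Lspace_class (- Lspace_repr f).
Let add (f g : L1) : L1 := Lspace_class (Lspace_repr f + Lspace_repr g).
Let scale (a : R) (f : L1) : L1 := Lspace_class (a *: Lspace_repr f).

Let oppE f : opp (Lspace_class f) = Lspace_class (- f).
Proof.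
apply/eq_Lspace_class; apply: filterS (Lspace_classK f) => x /= fx xT.
by rewrite -[LHS]/(- _ x) fx.
Qed.

Let addE f g : add (Lspace_class f) (Lspace_class g) = Lspace_class (f + g).
Proof.
apply/eq_Lspace_class.
apply: filterS2 (Lspace_classK f) (Lspace_classK g) => x /= fx gx xT.
by rewrite -[LHS]/(_ x + _ x) fx// gx.
Qed.

Let scaleE a f : scale a (Lspace_class f) = Lspace_class (a *: f).
Proof.
apply/eq_Lspace_class; apply: filterS (Lspace_classK f) => x /= fx xT.
by rewrite -[LHS]/(a * _ x) fx.
Qed.

Let addA : associative add.
Proof.
move=> f g h; rewrite -(Lspace_reprK f) -(Lspace_reprK g) -(Lspace_reprK h).
by rewrite !addE addrA.
Qed.

Let addC : commutative add.
Proof. by move=> f g; rewrite /add addrC. Qed.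

Let add0 : left_id zero add.
Proof. by move=> f; rewrite -(Lspace_reprK f) addE add0r. Qed.

Let addN : left_inverse zero opp add.
Proof. by move=> f; rewrite -(Lspace_reprK f) oppE addE addNr. Qed.

HB.instance Definition _ := GRing.isZmodule.Build L1 addA addC add0 addN.

Let scaleA a b f : scale a (scale b f) = scale (a * b) f.
Proof. by rewrite -(Lspace_reprK f) !scaleE scalerA. Qed.

Let scale1 : left_id 1 scale.
Proof. by move=> f; rewrite -(Lspace_reprK f) scaleE scale1r. Qed.

Let scaleDr : right_distributive scale +%R.
Proof.
move=> a f g; rewrite -(Lspace_reprK f) -(Lspace_reprK g).
by rewrite [_ + _ in LHS]addE !scaleE [RHS]addE scalerDr.
Qed.

Let scaleDl f : {morph scale^~ f : a b / a + b}.
Proof.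
by move=> a b; rewrite -(Lspace_reprK f) !scaleE [RHS]addE scalerDl.
Qed.

HB.instance Definition _ :=
  GRing.Zmodule_isLmodule.Build R L1 scaleA scale1 scaleDr scaleDl.

Lemma Lspace_class_is_linear : linear Lspace_class.
Proof. by move=> a f g; rewrite -addE -scaleE. Qed.

HB.instance Definition _ :=
  GRing.isLinear.Build R fT L1 *:%R Lspace_class Lspace_class_is_linear.

Let norm (f : L1) : R := fine ('N[mu]_1[EFin \o f])%E.

Let normE (f : fT) : norm (Lspace_class f) = fine ('N[mu]_1[EFin \o f])%E.
Proof.
congr fine; apply: Lnorm1_ae_eq (Lspace_measurable _) _ (Lfun_aeEqMfunK f).
exact: measurable_funPT f.
Qed.

Let ler_normD f g : norm (f + g) <= norm f + norm g.
Proof.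
rewrite -(Lspace_reprK f) -(Lspace_reprK g) -raddfD !normE.
exact: ler_LnormD.
Qed.

Let normrZ a f : norm (a *: f) = `|a| * norm f.
Proof.
rewrite -(Lspace_reprK f) -linearZ !normE; apply/EFin_inj.
rewrite EFinM !finite_norm_fine; exact: LnormZ.
Qed.

Let normr0_eq0 f : norm f = 0 -> f = 0.
Proof.
rewrite -(Lspace_reprK f) normE => /fine_Lnormr_eq0 f0.
exact/eq_Lspace_class.
Qed.

HB.instance Definition _ :=
  Lmodule_isNormed.Build R L1 ler_normD normrZ normr0_eq0.

Lemma LspaceType1_normE (f : L1) :
  `|f| = fine (\int[mu]_x `|f x|%:E)%E.
Proof. by rewrite -[LHS]/(norm f) /norm Lnorm1. Qed.

End LspaceType1_normedModType.

#[short(type="finNormedModType")]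
HB.structure Definition FinNormedModule (R : numFieldType) :=
  { V of NormedModule R V & Vector R V }.

(* Measurable functions on the line, with Lebesgue measure restricted to [0, 1]:
   classes are taken modulo equality a.e. on [0, 1] and the norm integrates over
   [0, 1], so values outside [0, 1] are irrelevant. *)
Definition L1 (R : realType) :=
  LspaceType1 (mrestr (@lebesgue_measure R) (measurable_itv `[0, 1])).

HB.instance Definition _ (R : realType) := NormedModule.on (L1 R).

(* The distortion of the restriction of T to X, in the extended reals; the
   infimum of the empty set is +oo.  If X is finite with at least two points
   and the set of admissible D is nonempty, then it has a least element. *)
Definition distortion (R : realType) (V W : normedModType R) (X : set V)
    (T : V -> W) : \bar R :=
  ereal_inf [set D%:E | D in [set D : R | exists2 s : R, 0 < s &
    forall x y, X x -> X y ->
      s * `|x - y| <= `|T x - T y| <= D * s * `|x - y| ] ].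

(* Main.v *)
Require Import Defs.
From HB Require Import structures.
From mathcomp Require Import all_boot all_order all_algebra.
From mathcomp Require Import all_classical all_reals all_analysis.
From mathcomp Require Import measurable_realfun.
From mathcomp Require Import ring zify.
Set Implicit Arguments.
Unset Strict Implicit.
Unset Printing Implicit Defensive.
Import Order.TTheory GRing.Theory Num.Theory.
Import numFieldNormedType.Exports.
Local Open Scope classical_set_scope.
Local Open Scope ring_scope.

(* Let W be a k x k matrix with entries +-1 and W W^T = k I, let e_j be the
   indicators of k disjoint intervals of length 1/k, and w_i = sum_j W_ij e_j.
   The configuration is X = {0} u {e_j} u {w_i}, so that n = 2k+1, |e_j| = 1/k
   and |w_i| = 1.  Let T be linear into a d-dimensional space, with constants s
   and D on X, and let f_i be a norm-one functional with f_i (T w_i) = |T w_i|.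
   The matrix M_ij = f_i (T e_j) has rank at most d and entries at most D s / k
   in absolute value, while tr (W^T M) = sum_i |T w_i| >= k s.  If P is the
   orthogonal projection onto the column space of M, then
   tr (W^T M) = <P W, M>, and the squared Hilbert-Schmidt norm of P W is
   k tr P <= k d.  By Cauchy-Schwarz, k^2 s^2 <= k d (D s)^2, that is,
   D^2 >= k / d = (n - 1) / (2 d). *)

(** * Hadamard matrices of order a power of two *)

Lemma sylvester_hadamard (R : nzRingType) (m : nat) :
  exists W : 'M[R]_(2 ^ m), (forall i j, W i j = 1 \/ W i j = -1) /\
    W *m W^T = (2 ^ m)%:R%:M.
Proof.
elim: m => [|m [W [W1 WW]]].
  exists 1%:M; split=> [i j|]; first by rewrite !ord1 mxE; left.
  by rewrite trmx1 mul1mx.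
rewrite expnS mul2n -addnn.
(* Sylvester's doubling: in the product with the transpose the off-diagonal blocks cancel and each
   diagonal block is twice [W *m W^T]. *)
exists (block_mx W W W (- W)); split=> [i j|].
  rewrite -(fintype.splitK i) -(fintype.splitK j).
  case: (fintype.split i) => i'; case: (fintype.split j) => j' /=;
    rewrite ?(block_mxEul, block_mxEur, block_mxEdl, block_mxEdr) // mxE.
  by case: (W1 i' j') => ->; [right|left; rewrite opprK].
rewrite tr_block_mx mulmx_block !linearN /= !mulmxN !mulNmx WW opprK subrr.
by rewrite [RHS]scalar_mx_block natrD raddfD.
Qed.

(** * The Hilbert-Schmidt inner product tr (A^T B) and orthogonal projections *)

Section TraceForm.
Variable R : realFieldType.

Lemma mxtrace_mul_trmx (m n : nat) (A B : 'M[R]_(m, n)) :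
  \tr (A^T *m B) = \sum_i \sum_j A i j * B i j.
Proof.
rewrite exchange_big; apply: eq_bigr => j _.
by rewrite mxE; apply: eq_bigr => i _; rewrite mxE.
Qed.

Lemma mxtrace_sqr_ge0 (m n : nat) (A : 'M[R]_(m, n)) : 0 <= \tr (A^T *m A).
Proof.
rewrite mxtrace_mul_trmx.
by do 2! (apply: sumr_ge0 => ? _); rewrite -expr2 sqr_ge0.
Qed.

Lemma mxtrace_sqr_eq0 (m n : nat) (A : 'M[R]_(m, n)) :
  \tr (A^T *m A) = 0 -> A = 0.
Proof.
rewrite mxtrace_mul_trmx => A0; apply/matrixP => i j; rewrite mxE.
have s0 i' j' : 0 <= A i' j' * A i' j' by rewrite -expr2 sqr_ge0.
have /(_ i isT) Ai0 := psumr_eq0P (fun i' _ => sumr_ge0 _ (fun j' _ => s0 i' j')) A0.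
have /(_ j isT)/eqP := psumr_eq0P (fun j' _ => s0 i j') Ai0.
by rewrite -expr2 sqrf_eq0 => /eqP.
Qed.

Lemma mxtrace_cauchy_schwarz (m n : nat) (A B : 'M[R]_(m, n)) :
  \tr (A^T *m B) ^+ 2 <= \tr (A^T *m A) * \tr (B^T *m B).
Proof.
set a := \tr (A^T *m A); set b := \tr (B^T *m B); set t := \tr (A^T *m B).
have tC : \tr (B^T *m A) = t by rewrite -mxtrace_tr trmx_mul trmxK.
have [/mxtrace_sqr_eq0 A0|a0] := eqVneq a 0.
  by rewrite /t /a A0 trmx0 !mul0mx mxtrace0 expr0n mul0r.
have {}a0 : 0 < a by rewrite lt_neqAle eq_sym a0 mxtrace_sqr_ge0.
(* The squared norm of a B - t A expands to a (a b - t^2), and a > 0 can be cancelled. *)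
have := mxtrace_sqr_ge0 (a *: B - t *: A).
rewrite (_ : _^T = a *: B^T - t *: A^T); last by rewrite linearB !linearZ.
rewrite !mulmxBl !mulmxBr -!scalemxAl -!scalemxAr.
have trN Q : \tr (- Q) = - \tr Q :> R := raddfN (@mxtrace R n) Q.
rewrite !(mxtraceD, trN, mxtraceZ) tC -/a -/b -/t => h.
rewrite -subr_ge0 -(pmulr_rge0 _ a0).
by apply: le_trans h _; rewrite le_eqVlt; apply/orP; left; apply/eqP; ring.
Qed.

(* The projection onto the row space of C := row_base A is C^T (C C^T)^-1 C. *)
Lemma orthogonal_projection (m n : nat) (A : 'M[R]_(m, n)) :
  exists P : 'M[R]_n,
    [/\ P^T = P, P *m P = P, A *m P = A & \tr P = (\rank A)%:R].
Proof.
have [C [Cfree AC]] : exists C : 'M[R]_(\rank A, n),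
    row_free C /\ (A <= C)%MS.
  by exists (row_base A); rewrite row_base_free eq_row_base.
set G := C *m C^T.
have Gu : G \in unitmx.
  (* If v G = 0 then v C has squared norm v G v^T = 0, so v C = 0, and v = 0 because the rows of C
     are free. *)
  rewrite -row_free_unit -kermx_eq0; apply/eqP/row_matrixP => i; rewrite row0.
  set v := row i _.
  have vG : v *m G = 0 by apply/sub_kermxP; rewrite row_sub.
  have vC : (v *m C)^T = 0.
    apply: mxtrace_sqr_eq0; rewrite trmxK trmx_mul mulmxA -(mulmxA v).
    by rewrite -/G vG mul0mx mxtrace0.
  move/(congr1 trmx): vC; rewrite trmxK trmx0 => vC.
  by apply: (row_free_inj Cfree); rewrite vC mul0mx.
have GT : (invmx G)^T = invmx G by rewrite trmx_inv trmx_mul trmxK.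
have CP : C *m (C^T *m invmx G *m C) = C.
  by rewrite !mulmxA -/G mulmxV // mul1mx.
exists (C^T *m invmx G *m C); split.
- by rewrite !trmx_mul trmxK GT mulmxA.
- by rewrite -[LHS]mulmxA CP.
- have /submxP[D AD] := AC.
  by rewrite {1}AD -[LHS]mulmxA CP -AD.
- by rewrite -mulmxA mxtrace_mulC -mulmxA -/G mulVmx // mxtrace1.
Qed.

(* Stands in for the duality of the operator norm and the trace norm, together
   with the bound of the latter by sqrt (rank M) times the Hilbert-Schmidt norm. *)
Lemma mxtrace_scaled_orthogonal_le (k : nat) (c : R) (W M : 'M[R]_k) :
  W *m W^T = c%:M ->
  \tr (W^T *m M) ^+ 2 <= c * (\rank M)%:R * \tr (M^T *m M).
Proof.
(* The projection fixes rows from the right; applying it to [M^T] and transposing gives P M = M. *)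
move=> WW; have [P [PT PP MP trP]] := orthogonal_projection M^T.
have PM : P *m M = M by rewrite -[RHS]trmxK -MP trmx_mul PT trmxK.
have <- : \tr ((P *m W)^T *m (P *m W)) = c * (\rank M)%:R.
  rewrite trmx_mul PT mulmxA -(mulmxA W^T) PP mxtrace_mulC mulmxA WW.
  by rewrite mul_scalar_mx linearZ /= trP mxrank_tr.
rewrite -[in leLHS]PM; apply: le_trans (mxtrace_cauchy_schwarz _ _).
by rewrite trmx_mul PT mulmxA.
Qed.

End TraceForm.

(** * The Hahn-Banach theorem in finite dimension *)

(** The vector [v - projv U v] is nonzero, so some coordinate of it is nonzero. That coordinate,
    composed with [\1 - projv U] and normalized, is the functional. *)
Lemma dual_separates (R : fieldType) (V : vectType R) (U : {vspace V}) (v : V) :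
  v \notin U -> exists2 phi : 'Hom(V, R^o), phi v = 1 &
    forall u, u \in U -> phi u = 0.
Proof.
move=> vU; pose w := v - projv U v.
have w0 : w != 0.
  apply: contra vU; rewrite subr_eq0 => /eqP ->; exact: memv_proj.
pose b := vbasis {:V}.
have [j bj] : exists j, coord b j w != 0.
  apply/existsP; apply: contraNT w0 => /existsPn bw.
  rewrite (coord_vbasis (memvf w)) big1 // => j _.
  by have /negPn/eqP -> := bw j; rewrite scale0r.
pose psi : 'Hom(V, R^o) := linfun (coord b j : V -> R^o).
exists ((coord b j w)^-1 *: (psi \o (\1 - projv U))%VF) => [|u uU];
  rewrite scale_lfunE comp_lfunE add_lfunE opp_lfunE id_lfunE lfunE /=.
  by rewrite -[LHS]/(_^-1 * _) mulVf.
by rewrite projv_id // subrr linear0 scaler0.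
Qed.

Section HahnBanach.
Variables (R : realType) (V : vectType R) (p : V -> R).
Hypothesis pD : forall x y, p (x + y) <= p x + p y.
Hypothesis pZ : forall a x, 0 <= a -> p (a *: x) = a * p x.

(** The value at [v] must lie above every f u - p (u - v) and below every p (u + v) - f u.
    Subadditivity makes the two families compatible, and the supremum of the first is chosen; adding
    a multiple of the separating functional [phi] imposes it without changing [f] on [U]. *)
Lemma hahn_banach_step (U : {vspace V}) (v : V) (f : 'Hom(V, R^o)) :
  v \notin U -> (forall u, u \in U -> f u <= p u) ->
  exists2 g : 'Hom(V, R^o), (forall u, u \in U -> g u = f u) &
    forall x, x \in (U + <[v]>)%VS -> g x <= p x.
Proof.
move=> vU fp; have [phi phiv phiU] := dual_separates vU.
pose S := [set (f u : R) - p (u - v) | u in [set u | u \in U]].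
have Sub u : u \in U -> ubound S (p (u + v) - f u).
  move=> uU _ [u' /= u'U <-]; rewrite lerBlDr addrAC lerBrDr.
  rewrite -[leLHS]/((f u' : R^o) + f u) -linearD.
  apply: le_trans (fp _ (memvD u'U uU)) _.
  rewrite (_ : u' + u = (u + v) + (u' - v)) ?pD //.
  by rewrite [RHS]addrACA subrr addr0 addrC.
have S0 : S !=set0 by exists ((f 0 : R) - p (0 - v)), 0 => //=; exact: mem0v.
have le1 u : u \in U -> (f u : R) + sup S <= p (u + v).
  by move=> uU; rewrite addrC -lerBrDr; apply: sup_le_ub => //; exact: Sub.
have le2 u : u \in U -> (f u : R) - sup S <= p (u - v).
  move=> uU; rewrite lerBlDr addrC -lerBlDr; apply: ub_le_sup; last by exists u.
  by exists (p (0 + v) - f 0); apply: Sub; exact: mem0v.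
pose c : R := sup S - f v.
have gU u : u \in U -> (f + c *: phi) u = f u.
  by move=> uU; rewrite add_lfunE scale_lfunE phiU // scaler0 addr0.
exists (f + c *: phi) => // _ /memv_addP[u uU [_ /vlineP[a ->] ->]].
rewrite linearD /= gU // linearZ /= add_lfunE scale_lfunE phiv.
rewrite -[leLHS]/(f u + a * (f v + c * 1) : R) mulr1 /c [f v + _]addrC subrK.
(* Positive homogeneity reduces u + a v to u + v or u - v, according to the sign of a. *)
have uaU : `|a|^-1 *: u \in U by exact: memvZ.
have sc x : a != 0 -> p x = `|a| * p (`|a|^-1 *: x).
  by move=> a0; rewrite -pZ // scalerA divff ?normr_eq0 // scale1r.
have fu : a != 0 -> f u = `|a| * f (`|a|^-1 *: u) :> R.
  by move=> a0; rewrite linearZ /= -[RHS]/(_ * (_ * _)) mulVKf // normr_eq0.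
have [a0|a0|->] := ltgtP a 0; last first.
- by rewrite mul0r addr0 scale0r addr0 fp.
- have an : a != 0 by rewrite gt_eqF.
  rewrite (fu an) (sc _ an); move: uaU; rewrite gtr0_norm // => uaU.
  rewrite -mulrDr ler_pM2l // scalerDr scalerA mulVf // scale1r.
  exact: le1.
have an : a != 0 by rewrite lt_eqF.
rewrite (fu an) (sc _ an); move: uaU; rewrite ltr0_norm // => uaU.
have -> : a * sup S = - a * - sup S by rewrite mulrNN.
rewrite -mulrDr ler_pM2l ?oppr_gt0 // scalerDr scalerA.
have -> : (- a)^-1 * a = -1 by rewrite invrN mulNr mulVf.
by rewrite scaleN1r le2.
Qed.

(** Induction on the codimension of [U], adjoining one vector at a time. *)
Lemma hahn_banach_findim (U : {vspace V}) (f : 'Hom(V, R^o)) :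
  (forall u, u \in U -> f u <= p u) ->
  exists2 g : 'Hom(V, R^o), (forall u, u \in U -> g u = f u) &
    forall x, g x <= p x.
Proof.
have [m] := ubnP (\dim {:V} - \dim U); elim: m U f => // m IH U f dimU fp.
have [/eqP UV|UV] := boolP (U == fullv).
  by exists f => // x; apply: fp; rewrite UV memvf.
have /subvPn[v _ vU] : ~~ ({:V} <= U)%VS.
  by apply: contra UV => VU; rewrite eqEsubv subvf.
have [g gf gp] := hahn_banach_step vU fp.
have dimlt : (\dim U < \dim (U + <[v]>))%N.
  rewrite ltn_neqAle dimvS ?addvSl // andbT; apply: contra vU => /eqP dimE.
  have /eqP -> : U == (U + <[v]>)%VS by rewrite eqEdim addvSl dimE leqnn.
  by rewrite memvE addvSr.
have [|h hg hp] := IH _ g _ gp.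
  have := dimvS (subvf (U + <[v]>)%VS); move: dimU dimlt; lia.
exists h => // u uU; rewrite hg ?gf //.
by apply: subvP uU; exact: addvSl.
Qed.

End HahnBanach.

(** * A scaled isometric copy of finite-dimensional l_1 in [L1] *)

Lemma Lspace_class_norm (d : measure_display) (T : measurableType d)
    (R : realType) (mu : {measure set T -> \bar R})
    (f : LfunType mu (@lexx _ _ 1%E)) :
  `|Lspace_class f| = fine (\int[mu]_x `|f x|%:E)%E.
Proof.
have := Lnorm1_ae_eq (Lspace_measurable _) (measurable_funPT f) (Lspace_classK f).
by rewrite LspaceType1_normE !Lnorm1; exact: congr1.
Qed.

Section DisjointIndicators.
Context (d : measure_display) (T : measurableType d) (R : realType).
Variables (mu : {measure set T -> \bar R}) (I : finType) (A : I -> set T).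
Hypotheses (mA : forall i, measurable (A i)) (tA : trivIset setT A).

(** By disjointness at most one term is nonzero at [x]. *)
Lemma normr_sum_indic_trivIset (c : I -> R) (x : T) :
  `|\sum_i c i * \1_(A i) x| = \sum_i `|c i| * \1_(A i) x.
Proof.
have [[i Aix]|nA] := pselect (exists i, A i x); last first.
  have nA0 i : \1_(A i) x = 0 :> R.
    by rewrite indicE memNset // => Aix; apply: nA; exists i.
  by rewrite !big1 ?normr0 // => i _; rewrite nA0 mulr0.
have nA0 j : j != i -> \1_(A j) x = 0 :> R.
  move=> ji; rewrite indicE memNset // => Ajx; move/eqP: ji; apply.
  by apply: tA => //; exists x.
rewrite (bigD1 i) //= [RHS](bigD1 i) //= !big1 => [|j /nA0 ->|j /nA0 ->].
- by rewrite !addr0 indicE mem_set // !mulr1.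
- by rewrite mulr0.
- by rewrite mulr0.
Qed.

Lemma integral_sum_indic (c : I -> R) : (forall i, 0 <= c i) ->
  (\int[mu]_x (\sum_i c i * \1_(A i) x)%:E = \sum_i (c i)%:E * mu (A i))%E.
Proof.
move=> c0.
rewrite (eq_integral (fun x => \sum_i (c i * \1_(A i) x)%:E)%E); last first.
  by move=> x _; rewrite sumEFin.
rewrite ge0_integral_sum //.
- apply: eq_bigr => i _; under eq_integral do rewrite EFinM.
  rewrite ge0_integralZl_EFin ?integral_indic ?setIT //.
  by apply/measurable_EFinP; exact: measurable_indic.
- move=> i; apply/measurable_EFinP; apply: measurable_funM => //.
- by move=> i x _; rewrite lee_fin mulr_ge0.
Qed.

Lemma indic_Lfun1 (B : set T) : measurable B -> (mu B < +oo)%E ->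
  (\1_B : T -> R) \in Lfun mu 1.
Proof.
move=> mB muB; rewrite inE; apply/andP; split; rewrite inE /=.
  exact: measurable_indic.
rewrite /finite_norm Lnorm1; under eq_integral do rewrite /= ger0_norm //.
by rewrite integral_indic // setIT.
Qed.

Lemma L1_norm_sum_indic (muA : forall i, (mu (A i) < +oo)%E) (c : I -> R) :
  `|\sum_i c i *: Lspace_class (Lfun_Sub (@lexx _ _ 1%E)
      (indic_Lfun1 (mA i) (muA i)))| = \sum_i `|c i| * fine (mu (A i)).
Proof.
under eq_bigr do rewrite -linearZ.
rewrite -linear_sum Lspace_class_norm.
set f := (\sum_i _).
have fE x : f x = \sum_i c i * \1_(A i) x.
  by rewrite /f; elim/big_rec2 : _ => //= i y1 y2 _ <-.
under eq_integral do rewrite fE normr_sum_indic_trivIset.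
rewrite integral_sum_indic // -sum_fine.
  by apply: eq_bigr => i _; rewrite fineM // ge0_fin_numE.
by move=> i _; rewrite fin_numM // ge0_fin_numE.
Qed.

End DisjointIndicators.

Lemma ell1_embeds_L1 (R : realType) (k : nat) : (0 < k)%N ->
  exists e : 'I_k -> L1 R, forall c : 'I_k -> R,
    `|\sum_i c i *: e i| = k%:R^-1 * \sum_i `|c i|.
Proof.
move=> k0; have kR : 0 < k%:R :> R by rewrite ltr0n.
(* Half-open intervals are genuinely disjoint; each lies in [0, 1] and has measure 1/k, whence the
   factor in the norm. *)
pose A (i : 'I_k) : set R := `](i%:R / k%:R), (i.+1%:R / k%:R)]%classic.
have mA i : measurable (A i : set (measurableTypeR R)) by exact: measurable_itv.
have tA : trivIset setT A.
  move=> i j _ _ [x [/=]]; rewrite /A /= !in_itv /= => /andP[i1 i2] /andP[j1 j2].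
  have := lt_le_trans i1 j2; have := lt_le_trans j1 i2.
  rewrite !ltr_pM2r ?invr_gt0 // !ltr_nat => ij ji.
  by apply/val_inj/eqP; rewrite eqn_leq -ltnS ji -ltnS ij.
pose mu := mrestr (@lebesgue_measure R) (measurable_itv `[0, 1]).
have muA i : mu (A i) = (k%:R^-1)%:E.
  rewrite /mu /mrestr setIidl.
    rewrite lebesgue_measure_itv /= lte_fin ltr_pM2r ?invr_gt0 // ltr_nat ltnSn.
    by rewrite -EFinD -mulrBl -natrB // subSnn mul1r.
  move=> x; rewrite /A /= !in_itv /= => /andP[i1 i2].
  rewrite (le_trans _ (ltW i1)) ?divr_ge0 //=.
  by rewrite (le_trans i2) // ler_pdivrMr // mul1r ler_nat.
have muAoo i : (mu (A i) < +oo)%E by rewrite muA ltry.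
exists (fun i => Lspace_class (Lfun_Sub (@lexx _ _ 1%E)
  (indic_Lfun1 (mA i) (muAoo i)))) => c.
rewrite (L1_norm_sum_indic mA tA) mulr_sumr.
apply: eq_bigr => i _; rewrite [RHS]mulrC; congr (_ * _).
exact: congr1 (muA i).
Qed.

(** * Norming functionals and the rank argument *)

Lemma norming_functional (R : realType) (Y : finNormedModType R) (y : Y) :
  exists2 f : 'Hom(Y, R^o), f y = `|y| & forall x, `|f x : R| <= `|x|.
Proof.
suff [f fy fle] : exists2 f : 'Hom(Y, R^o), f y = `|y| &
    forall x, (f x : R) <= `|x|.
  (* The one-sided bound at -x supplies the other side. *)
  exists f => // x; rewrite ler_norml fle andbT lerNl.
  by rewrite -[leLHS]/(- (f x : R^o)) -linearN -(normrN x) fle.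
have [->|y0] := eqVneq y 0.
  exists 0; first by rewrite linear0 normr0.
  by move=> x; rewrite zero_lfunE normr_ge0.
have [|phi phiy _] := @dual_separates _ Y 0%VS y; first by rewrite memv0.
(* On the line through [y] this is the functional to be extended; there it is dominated by the
   norm. *)
have fE a : (`|y| *: phi : 'Hom(Y, R^o)) (a *: y) = a * `|y| :> R.
  rewrite scale_lfunE linearZ /= phiy -[LHS]/(`|y| * (a * 1)).
  by rewrite mulr1 mulrC.
have [||| g gf gle] := @hahn_banach_findim R Y Num.norm _ _ <[y]>%VS
  (`|y| *: phi).
- exact: ler_normD.
- by move=> a x a0; rewrite normrZ ger0_norm.
- move=> _ /vlineP[a ->]; rewrite fE normrZ ler_wpM2r //; exact: ler_norm.
exists g => //; rewrite gf ?memv_line //.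
by have := fE 1; rewrite scale1r mul1r.
Qed.

(** The core inequality, later used with y_j = T e_j, a = s and b = D s / k. It compares [W] with
    the matrix of norming functionals evaluated at the y_j. *)
Lemma scaled_orthogonal_image_le (R : realType) (Y : finNormedModType R)
    (k : nat) (W : 'M[R]_k) (y : 'I_k -> Y) (a b : R) :
  (0 < k)%N -> W *m W^T = k%:R%:M -> 0 <= a ->
  (forall j, `|y j| <= b) ->
  (forall i, a <= `|\sum_j W i j *: y j|) ->
  a ^+ 2 <= k%:R * (\dim {:Y})%:R * b ^+ 2.
Proof.
move=> k0 WW a0 yb aW; set d := \dim _.
have kR : 0 < k%:R :> R by rewrite ltr0n.
have /choice[f fP] : forall i, exists f : 'Hom(Y, R^o),
    f (\sum_j W i j *: y j) = `|\sum_j W i j *: y j| /\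
    forall x, `|f x : R| <= `|x|.
  by move=> i; have [f] := norming_functional (\sum_j W i j *: y j); exists f.
pose M : 'M[R]_k := \matrix_(i, j) f i (y j).
pose B := vbasis {:Y}.
(* Expanding each y_j in a basis of [Y] factors [M] through dimension [d]. *)
have rM : (\rank M <= d)%N.
  have -> : M = (\matrix_(i < k, l < d) (f i B`_l : R)) *m
                (\matrix_(l < d, j < k) coord B l (y j)).
    apply/matrixP => i j; rewrite !mxE {1}(coord_vbasis (memvf (y j))).
    rewrite linear_sum; apply: eq_bigr => l _; rewrite !mxE linearZ /=.
    by rewrite mulrC.
  by rewrite (leq_trans (mxrankM_maxl _ _)) // rank_leq_col.
have trWM : k%:R * a <= \tr (W^T *m M).
  rewrite mxtrace_mul_trmx -[leLHS]mulrC mulr_natr -[X in _ *+ X]card_ord.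
  rewrite -sumr_const; apply: ler_sum => i _; apply: le_trans (aW i) _.
  rewrite -(fP i).1 linear_sum le_eqVlt; apply/orP; left; apply/eqP.
  by apply: eq_bigr => j _; rewrite mxE linearZ.
have trMM : \tr (M^T *m M) <= k%:R * (k%:R * b ^+ 2).
  rewrite mxtrace_mul_trmx.
  rewrite -{1}[k in k%:R]card_ord mulr_natl -sumr_const; apply: ler_sum => i _.
  rewrite -[k in k%:R]card_ord mulr_natl -sumr_const; apply: ler_sum => j _.
  rewrite mxE -expr2 -real_normK ?num_real // lerXn2r ?nnegrE //.
    exact: le_trans (normr_ge0 _) (yb j).
  exact: le_trans ((fP i).2 _) (yb j).
have : (k%:R * a) ^+ 2 <= k%:R * d%:R * (k%:R * (k%:R * b ^+ 2)).
  apply: le_trans (_ : \tr (W^T *m M) ^+ 2 <= _).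
    have ka0 : 0 <= k%:R * a by rewrite mulr_ge0 // ltW.
    by rewrite lerXn2r ?nnegrE // (le_trans ka0).
  apply: le_trans (mxtrace_scaled_orthogonal_le _ WW) _.
  apply: ler_pM => //; first exact: mxtrace_sqr_ge0.
  by rewrite ler_pM2l // ler_nat.
rewrite [leRHS](_ : _ = k%:R ^+ 2 * (k%:R * d%:R * b ^+ 2)); last by ring.
by rewrite exprMn ler_pM2l // exprn_gt0.
Qed.

(** * The configuration of 2k+1 points and its distortion *)

Section Configuration.
Variables (R : realType) (k : nat) (W : 'M[R]_k).

(** The index type has 2k+1 elements: [None] stands for the origin, [inl j] for e_j and [inr i] for
    w_i. *)
Definition config_coef (o : option ('I_k + 'I_k)) : 'I_k -> R :=
  match o with
  | None => fun=> 0
  | Some (inl j) => fun l => (l == j)%:R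
  | Some (inr i) => W i
  end.

Hypotheses (k1 : (1 < k)%N) (W1 : forall i j, W i j = 1 \/ W i j = -1)
  (WW : W *m W^T = k%:R%:M).

(** Equal rows of [W] at distinct indices would have inner product both k and 0. A row of [W] has no
    zero entry, while a unit vector has one since k > 1. *)
Lemma config_coef_inj : injective config_coef.
Proof.
have W0 i j : W i j != 0 by case: (W1 i j) => ->; rewrite ?oppr_eq0 oner_eq0.
have k0 : (0 < k)%N := ltnW k1.
have other (j : 'I_k) : exists l : 'I_k, l != j.
  have [j0|j0] := eqVneq (val j) 0%N.
    by exists (Ordinal k1); rewrite -val_eqE /= j0.
  by exists (Ordinal k0); rewrite -val_eqE /= eq_sym.
have delta_inj (j j' : 'I_k) :
    (fun l => (l == j)%:R : R) = (fun l => (l == j')%:R) -> j = j'.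
  move/(congr1 (fun h => h j)) => /=; rewrite eqxx.
  by case: (eqVneq j j') => // _ /eqP; rewrite oner_eq0.
have row_inj (i i' : 'I_k) : (W i : 'I_k -> R) = W i' -> i = i'.
  move=> Wi; apply/eqP; apply: contraTT isT => ii'.
  have : (W *m W^T) i i = (W *m W^T) i i'.
    by rewrite !mxE; apply: eq_bigr => l _; rewrite !mxE Wi.
  move/eqP; rewrite WW !mxE eqxx (negbTE ii') mulr1n mulr0n.
  by rewrite pnatr_eq0 gtn_eqF.
have W_delta (i j : 'I_k) : (fun l => (l == j)%:R : R) <> W i.
  move=> Wi; have [l lj] := other j.
  by have := W0 i l; rewrite -Wi (negbTE lj) eqxx.
have zero_delta (j : 'I_k) : (fun=> 0 : R) <> (fun l => (l == j)%:R).
  by move/(congr1 (fun h => h j))/esym/eqP; rewrite eqxx oner_eq0.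
have zero_W (i : 'I_k) : (fun=> 0 : R) <> W i.
  by move=> Wi; have := W0 i i; rewrite -Wi eqxx.
move=> [[j|i]|] [[j'|i']|] //=.
- by move/delta_inj ->.
- by move/W_delta.
- by move/esym/zero_delta.
- by move/esym/W_delta.
- by move/row_inj ->.
- by move/esym/zero_W.
- by move/zero_delta.
- by move/zero_W.
Qed.

Variables (V : normedModType R) (e : 'I_k -> V).
Hypothesis eN : forall c : 'I_k -> R,
  `|\sum_i c i *: e i| = k%:R^-1 * \sum_i `|c i|.

Definition config_point (o : option ('I_k + 'I_k)) : V :=
  \sum_l config_coef o l *: e l.

Lemma config_point_inj : injective config_point.
Proof.
move=> o o' oo'; apply: config_coef_inj; apply/funext => l.
have : `|config_point o - config_point o'| = 0 by rewrite oo' subrr normr0.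
rewrite /config_point -sumrB; under eq_bigr do rewrite -scalerBl.
rewrite (eN (fun l => config_coef o l - config_coef o' l)) => /eqP.
rewrite mulf_eq0 invr_eq0 pnatr_eq0 gtn_eqF ?(ltnW k1) //=.
move/eqP/psumr_eq0P => /(_ (fun=> fun=> normr_ge0 _))/(_ l isT)/eqP.
by rewrite normr_eq0 subr_eq0 => /eqP.
Qed.

Lemma sqrt_le_distortion (Y : finNormedModType R) (T : {linear V -> Y})
    (X : set V) : (0 < \dim {:Y})%N -> (forall o, X (config_point o)) ->
  ((Num.sqrt (k%:R / (\dim {:Y})%:R))%:E <= distortion X T)%E.
Proof.
move=> d0 pX; have k0 : (0 < k)%N := ltnW k1.
have kR : 0 < k%:R :> R by rewrite ltr0n.
have dR : 0 < (\dim {:Y})%:R :> R by rewrite ltr0n.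
have x0 : config_point None = 0.
  by rewrite /config_point big1 // => l _; rewrite scale0r.
have xl j : config_point (Some (inl j)) = e j.
  rewrite /config_point (bigD1 j) //= eqxx scale1r big1 ?addr0 // => l lj.
  by rewrite (negbTE lj) scale0r.
have nl j : `|e j| = k%:R^-1.
  rewrite -xl /config_point eN (bigD1 j) //= eqxx normr1 big1 ?addr0 ?mulr1 //.
  by move=> l lj; rewrite (negbTE lj) normr0.
have nr i : `|config_point (Some (inr i))| = 1.
  rewrite /config_point eN (eq_bigr (fun=> 1)) => [|l _].
    by rewrite sumr_const card_ord mulVf ?gt_eqF.
  by rewrite /=; case: (W1 i l) => ->; rewrite ?normrN normr1.
apply: le_ereal_inf_tmp => _ [D [s s0 sD] <-]; rewrite lee_fin.
(* Comparison with the origin turns bounds on distances into bounds on norms. *)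
have sD0 o : s * `|config_point o| <= `|T (config_point o)|
    <= D * s * `|config_point o|.
  by have := sD _ _ (pX o) (pX None); rewrite x0 (linear0 T) !subr0.
(* A point of norm 1 gives s <= D s. The sign of [D] is what allows square roots to be taken at the
   end. *)
have D0 : 0 <= D.
  have /andP[/le_trans h /h] := sD0 (Some (inr (Ordinal k0))).
  rewrite nr !mulr1 -[leLHS]mul1r ler_pM2r //; exact: le_trans.
have : s ^+ 2 <= k%:R * (\dim {:Y})%:R * (D * s * k%:R^-1) ^+ 2.
  apply: (scaled_orthogonal_image_le (y := T \o e) k0 WW (ltW s0)) => [j|i].
    by have /andP[_] := sD0 (Some (inl j)); rewrite xl nl.
  have /andP[+ _] := sD0 (Some (inr i)).
  rewrite nr mulr1 /config_point linear_sum /=.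
  by under eq_bigr do rewrite linearZ.
rewrite [leRHS](_ : _ = s ^+ 2 * (D ^+ 2 * (\dim {:Y})%:R / k%:R)); last first.
  by field; rewrite gt_eqF.
rewrite -[leLHS]mulr1 ler_pM2l ?exprn_gt0 // ler_pdivlMr // mul1r => h.
rewrite -(ger0_norm D0) -sqrtr_sqr; apply: ler_wsqrtr.
by rewrite ler_pdivrMr.
Qed.
End Configuration.

Theorem mainTheorem8 (R : realType) (N : nat) :
  exists2 n : nat, (N <= n)%N &
  exists2 X : set (L1 R), (X #= `I_n)%card &
  forall (d : nat) (Y : finNormedModType R) (T : {linear L1 R -> Y}),
    (1 <= d)%N -> \dim {: Y} = d ->
    ((Num.sqrt ((n%:R - 1) / (2 * d%:R)))%:E <= distortion X T)%E.
Proof.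
(* The exponent [N.+1] ensures k > 1 even for N = 0, and makes n = 2k+1 exceed [N]. *)
pose k := (2 ^ N.+1)%N.
have Nk : (N.+1 < k)%N := ltn_expl _ (ltnSn 1).
have k1 : (1 < k)%N := leq_ltn_trans (ltn0Sn N) Nk.
have [W [W1 WW]] := sylvester_hadamard R N.+1.
have [e eN] := ell1_embeds_L1 R (ltnW k1).
have ptI := config_point_inj k1 W1 WW eN.
exists (k + k).+1; first by rewrite leqW // (leq_trans (ltnW (ltnW Nk))) ?leq_addr.
exists (range (config_point W e)).
  rewrite (card_eql (inj_card_eq (in2W ptI))) (card_eqr card_II).
  have <- : #|{: option ('I_k + 'I_k)}| = (k + k).+1.
    by rewrite card_option card_sum card_ord.
  rewrite -(card_eql (inj_card_eq (in2W enum_rank_inj))).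
  suff -> : range (@enum_rank (option ('I_k + 'I_k)%type)) = setT by [].
  by apply/seteqP; split=> // i _; exists (enum_val i) => //; rewrite enum_valK.
move=> d Y T d1 dimY; rewrite -dimY in d1 *.
(* Here n - 1 = 2k, so the factor 2 cancels. *)
rewrite [X in Num.sqrt X](_ : _ = k%:R / (\dim {:Y})%:R); last first.
  rewrite -natr1 addrK natrD; field.
  by rewrite pnatr_eq0 -lt0n.
by apply: (sqrt_le_distortion k1 W1 WW eN) => // o; exists o.
Qed.
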